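(* Consider, for each $p$, the model $Y = X\beta^\star + Z$ described in the context, with $\beta^\star \in \mathcal{B}_{p,s}$ and the estimator $\hat\beta_{\mathrm{MLE}} \in \arg\min_{\beta \in \mathcal{B}_{p,s}} \|\Sigma^{-1}(Y - X\beta)\|_2^2$. Fix $\delta \in (0,1)$. 1. If $s = o(p)$ and $s \to +\infty$ as $p \to +\infty$, set $n^\star := 2 s \log(p/s)$. 2. If $s = \alpha p$ for some constant $\alpha \in (0,1)$, set $n^\star := 2 h(\alpha) p$. In both settings, if there exists $\varepsilon > 0$ such that (for all sufficiently large $p$) $$ n_1 \log\left(1 + \frac{\delta s}{2\sigma_1^2}\right) + n_2 \log\left(1 + \frac{\delta s}{2\sigma_2^2}\right) \ge (1+\varepsilon) n^\star, $$ then $$ \mathbb{P}\Big( |\operatorname{supp}(\beta^\star) \,\triangle\, \operatorname{supp}(\hat\beta_{\mathrm{MLE}})| < 2\delta s \Big) \ge 1 - \exp\{-(\varepsilon + o(1)) n^\star/2\} \xrightarrow{p\to+\infty} 1 .$$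
   Context: All quantities may depend on $p$, and asymptotics are as $p \to +\infty$. Sample sizes $n_1, n_2 \ge 1$, $n = n_1 + n_2$. The design $X \in \mathbb{R}^{n\times p}$ has i.i.d. $\mathcal{N}(0,1)$ entries. Noise levels satisfy $0 < \sigma_1^2 < \sigma_2^2$; $\Sigma = \begin{pmatrix} \sigma_1 I_{n_1} & 0 \\ 0 & \sigma_2 I_{n_2}\end{pmatrix}$, $W \sim \mathcal{N}(0, I_n)$ independent of $X$, and $Z = \Sigma W$. The signal $\beta^\star$ is deterministic and belongs to $\mathcal{B}_{p,s} := \{\beta \in \{0,1\}^p : \|\beta\|_0 = s\}$, where $\|\beta\|_0$ is the number of nonzero coordinates. $\operatorname{supp}(\beta) = \{i : \beta_i \neq 0\}$, $A \triangle B = (A\cup B)\setminus(A\cap B)$. $h(x) = -x\log x - (1-x)\log(1-x)$ is the binary entropy (natural logarithm). The estimator $\hat\beta_{\mathrm{MLE}}$ (the maximum likelihood estimator over $\mathcal{B}_{p,s}$) uses knowledge of $\Sigma$. *)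

(* Defs.v *)
From HB Require Import structures.
From mathcomp Require Import all_boot all_order all_algebra.
From mathcomp Require Import all_classical all_reals all_analysis.
Set Implicit Arguments. Unset Strict Implicit. Unset Printing Implicit Defensive.
Import Order.TTheory GRing.Theory Num.Theory.
Import numFieldNormedType.Exports.
Local Open Scope classical_set_scope.
Local Open Scope ring_scope.

Definition bin_entropy {R : realType} (x : R) : R :=
  - x * ln x - (1 - x) * ln (1 - x).

Definition mutually_independent {d} {T : measurableType d} {R : realType}
  (P : probability T R) (I : finType) (F : I -> T -> R) : Prop :=
  forall (J : {set I}) (B : I -> set R),
    (forall i, measurable (B i)) ->
    P (\bigcap_(i in [set` mem J]) (F i @^-1` B i)) =
    (\prod_(i in J) P (F i @^-1` B i))%E.

Definition std_gaussian {d} {T : measurableType d} {R : realType}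
  (P : probability T R) (f : T -> R) : Prop :=
  measurable_fun setT f /\
  forall B : set R, measurable B -> P (f @^-1` B) = normal_prob 0 1 B.

Definition noise_level {R : realType} (n1 : nat) (sigma1 sigma2 : R) (n : nat)
  (i : 'I_n) : R := if (i < n1)%N then sigma1 else sigma2.

Definition beta_of {R : realType} (p : nat) (S : {set 'I_p}) : 'I_p -> R :=
  fun j => if j \in S then 1 else 0.

Definition design_apply {R : realType} (n p : nat) (X : 'I_n -> 'I_p -> R)
  (beta : 'I_p -> R) (i : 'I_n) : R := \sum_(j < p) X i j * beta j.

(* || Sigma^{-1} (Y - X beta) ||_2^2 with Sigma = diag(sig) *)
Definition mle_objective {R : realType} (n p : nat) (sig : 'I_n -> R)
  (Y : 'I_n -> R) (X : 'I_n -> 'I_p -> R) (beta : 'I_p -> R) : R :=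
  \sum_(i < n) ((Y i - design_apply X beta i) / sig i) ^+ 2.

(* supports of elements of B_{p,s}: binary vectors with exactly s ones *)
Definition in_Bps (p s : nat) (S : {set 'I_p}) : bool := #|S| == s.

Definition symdiff {T : finType} (A B : {set T}) : {set T} :=
  (A :|: B) :\: (A :&: B).

(* Main.v *)
(** If the MLE is [S], then [mle_objective] at [S] is at most its value at the
    true support.  For fixed [S] with [D := symdiff Sstar S], Chernoff's bound at
    exponent 1/4 controls the probability of this by
    E exp((sum_i W_i^2 - (W_i + U_i / sig_i)^2) / 4), where U_i is a signed sum of
    the #|D| entries of row i of the design indexed by D.  Integrating out W_i and
    then the entries of the row one at a time evaluates the expectation exactly as
    prod_i (1 + #|D| / (4 sig_i^2))^(-1/2).  When #|D| >= 2 delta s this is at most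
    exp(-(1 + eps) nstar / 2) by hypothesis, and the union bound over the
    'C(p, s) <= exp((1 + o(1)) nstar / 2) candidate supports costs only the 1. *)

Require Import Defs.
From HB Require Import structures.
From mathcomp Require Import all_boot all_order all_algebra.
From mathcomp Require Import all_classical all_reals all_analysis.
From mathcomp Require Import measurable_realfun.
From mathcomp Require Import ring lra.
Import Order.TTheory GRing.Theory Num.Theory.
Import numFieldNormedType.Exports.
Local Open Scope classical_set_scope.
Local Open Scope ring_scope.


(** * Gaussian integrals and integration over an independent pair *)

Lemma ge0_integral_normal_prob {R : realType} (m s : R) (f : R -> \bar R) :
  measurable_fun setT f -> (forall x, 0 <= f x)%E ->
  (\int[normal_prob m s]_x f x =
   \int[lebesgue_measure]_x (f x * (normal_pdf m s x)%:E))%E.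
Proof.
move=> mf f0.
have dom := normal_prob_dominates m s.
rewrite -(Radon_Nikodym_SigmaFinite.change_of_variables dom)//=.
apply: ae_eq_integral => //=.
- apply: emeasurable_funM => //.
  apply: (measurable_int lebesgue_measure).
  exact: (Radon_Nikodym_SigmaFinite.f_integrable dom).
- apply: emeasurable_funM => //=.
  by apply/measurable_EFinP; exact: measurable_normal_pdf.
(* The Radon-Nikodym derivative and [normal_pdf] have the same integral over every measurable set,
   so they agree almost everywhere. *)
- apply: ae_eqe_mul2l => /=.
  apply: integral_ae_eq => //=.
  + exact: (Radon_Nikodym_SigmaFinite.f_integrable dom).
  + by apply/measurable_EFinP; exact: measurable_normal_pdf.
  + move=> E _ mE.
    by rewrite -(Radon_Nikodym_SigmaFinite.f_integral dom).
Qed.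

(* Completing the square turns the integrand into a multiple of the density of
   N(b / (1 + 2c), 1 / (1 + 2c)). *)
Lemma integral_std_normal_expR_quadratic {R : realType} (c b : R) : 0 <= c ->
  (\int[normal_prob 0 1]_x (expR (- (c * x ^+ 2) + b * x))%:E =
   ((Num.sqrt (1 + 2 * c))^-1 * expR (b ^+ 2 / (2 * (1 + 2 * c))))%:E)%E.
Proof.
move=> c0.
have q0 : 0 < 1 + 2 * c by lra.
set K := (X in _ = X%:E).
have mq : measurable_fun setT (fun x : R => expR (- (c * x ^+ 2) + b * x)).
  apply: measurableT_comp => //; apply: measurable_funD.
    apply: measurableT_comp => //; exact: measurable_funM.
  exact: measurable_funM.
have {}mq := measurableT_comp (@EFin_measurable R setT) mq.
rewrite (ge0_integral_normal_prob _ _ _ mq); last first.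
  by move=> x; rewrite lee_fin expR_ge0.
set t := (Num.sqrt (1 + 2 * c))^-1.
have t0 : 0 < t by rewrite invr_gt0 sqrtr_gt0.
have tE : t ^+ 2 = (1 + 2 * c)^-1 by rewrite exprVn sqr_sqrtr// ltW.
have K0 : 0 <= K by rewrite /K mulr_ge0// ?expR_ge0// ltW.
transitivity (\int[lebesgue_measure]_x
  (K%:E * (normal_pdf (b / (1 + 2 * c)) t x)%:E))%E.
  apply: eq_integral => x _; rewrite -!EFinM; congr EFin.
  rewrite !normal_pdfE ?gt_eqF// /K /normal_peak /normal_fun -/t.
  have -> : Num.sqrt (t ^+ 2 * pi *+ 2) = t * Num.sqrt (1 ^+ 2 * pi *+ 2).
    by rewrite expr1n mul1r -mulrnAr sqrtrM ?sqr_ge0// sqrtr_sqr gtr0_norm.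
  have p0 : 0 < Num.sqrt (1 ^+ 2 * pi *+ 2) :> R.
    by rewrite sqrtr_gt0 expr1n mul1r mulrn_wgt0// pi_gt0.
  set p := Num.sqrt _ in p0 *.
  rewrite mulrCA -expRD (invfM t p).
  have -> : t * expR (b ^+ 2 / (2 * (1 + 2 * c))) * (t^-1 * p^-1 *
     expR (- (x - b / (1 + 2 * c)) ^+ 2 / (t ^+ 2 *+ 2))) =
     p^-1 * expR (b ^+ 2 / (2 * (1 + 2 * c)) + (- (x - b / (1 + 2 * c)) ^+ 2 / (t ^+ 2 *+ 2))).
    by rewrite expRD; field; rewrite !gt_eqF.
  congr (_ * expR _); rewrite tE; field.
  by rewrite !gt_eqF//; lra.
rewrite ge0_integralZl_EFin//; last 2 first.
  by move=> x _; rewrite lee_fin normal_pdf_ge0.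
  by apply/measurable_EFinP; exact: measurable_normal_pdf.
by rewrite integral_normal_pdf mule1.
Qed.

(** Factorisation on rectangles determines the joint law: by uniqueness of the product measure,
    [(V, Z)] has law (law of [V]) x [nu], and Tonelli splits the integral. *)
Lemma ge0_integral_independent_pair {R : realType} (d d1 d2 : measure_display)
  (T : measurableType d) (T1 : measurableType d1) (T2 : measurableType d2)
  (P : probability T R) (V : T -> T1) (Z : T -> T2) (nu : probability T2 R)
  (g : T1 * T2 -> \bar R) :
  measurable_fun setT V -> measurable_fun setT Z ->
  (forall A B, measurable A -> measurable B ->
    P (V @^-1` A `&` Z @^-1` B) = P (V @^-1` A) * nu B)%E ->
  measurable_fun setT g -> (forall z, 0 <= g z)%E ->
  (\int[P]_w g (V w, Z w) = \int[P]_w \int[nu]_y g (V w, y))%E.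
Proof.
move=> mV mZ indep mg g0.
pose V' : {mfun T >-> T1} := HB.pack V (isMeasurableFun.Build _ _ _ _ _ mV).
have mVZ : measurable_fun setT (fun w => (V w, Z w)).
  exact: measurable_fun_pair.
pose VZ : {mfun T >-> (T1 * T2)%type} :=
  HB.pack (fun w => (V w, Z w)) (isMeasurableFun.Build _ _ _ _ _ mVZ).
have -> : (\int[P]_w g (V w, Z w) = \int[distribution P VZ]_z g z)%E.
  by rewrite ge0_integral_distribution.
have -> : (\int[P]_w \int[nu]_y g (V w, y) =
  \int[distribution P V']_v \int[nu]_y g (v, y))%E.
  rewrite (@ge0_integral_distribution _ _ _ _ _ P V')//.
  - exact: (@measurable_fun_fubini_tonelli_F _ _ _ _ _ nu g).
  - by move=> y; exact: integral_ge0.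
rewrite -(@fubini_tonelli1 _ _ _ _ _ (distribution P V') nu _ mg g0).
apply: eq_measure_integral => A mA _.
by apply/esym/product_measure_unique => //= A1 B1 mA1 mB1; exact: indep.
Qed.

(** * Sigma-algebras generated by subfamilies of independent variables *)

Section cylinders.
Context {R : realType} {d : measure_display} {T : measurableType d}.
Context (P : probability T R) {I : finType} (F : I -> T -> R).
Implicit Types J : {set I}.

(** A pi-system generating the sigma-algebra of the variables [F i], [i] in [J]. Measurability for
    [sigmaT J] expresses that a function depends only on these variables. *)
Definition cylinders J : set (set T) :=
  [set \bigcap_(i in [set` mem J]) (F i @^-1` B i) | B in
    [set B : I -> set R | forall i, measurable (B i)]].

Local Notation sigmaT J := (g_sigma_algebraType (cylinders J)).

Lemma cylindersI J : setI_closed (cylinders J).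
Proof.
move=> _ _ [B mB <-] [C mC <-]; exists (fun i => B i `&` C i).
  by move=> i; exact: measurableI.
by rewrite -bigcapI; apply: eq_bigcapr => i _; rewrite preimage_setI.
Qed.

Lemma cylindersT J : cylinders J setT.
Proof.
by exists (fun=> setT) => //; apply/seteqP; split.
Qed.

Lemma cylinders_sub J J' : J \subset J' -> cylinders J `<=` cylinders J'.
Proof.
move=> /fintype.subsetP sJ _ [B mB <-].
exists (fun i => if i \in J then B i else setT) => [i|].
  by case: ifP.
apply/seteqP; split=> w Bw i /= iJ.
  by have := Bw i (sJ _ iJ); rewrite iJ.
by case: ifP => // iJ'; exact: Bw.
Qed.

Lemma measurable_fun_sigma_cylinders_sub J J' (f : T -> R) : J \subset J' ->
  measurable_fun setT (f : sigmaT J -> R) ->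
  measurable_fun setT (f : sigmaT J' -> R).
Proof.
move=> sJ mf _ B mB.
have : <<s cylinders J >> (setT `&` f @^-1` B) := mf measurableT B mB.
by move/(sub_sigma_algebra2 (cylinders_sub _ _ sJ)).
Qed.

Lemma measurable_fun_sigma_cylinders i J : i \in J ->
  measurable_fun setT (F i : sigmaT J -> R).
Proof.
move=> iJ _ B mB; apply: sub_sigma_algebra; rewrite setTI.
exists (fun j => if j == i then B else setT) => [j|]; first by case: ifP.
apply/seteqP; split=> w.
  by move=> /(_ i); rewrite /= eqxx; exact.
by move=> Bw j /= _; case: eqP => // ->.
Qed.

Hypothesis mF : forall i, measurable_fun setT (F i).

Lemma cylinders_measurable J : cylinders J `<=` measurable.
Proof.
move=> _ [B mB <-]; apply: fin_bigcap_measurable => // i _.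
by rewrite -[X in measurable X]setTI; exact: mF.
Qed.

Lemma sigma_cylinders_measurable J (A : set T) :
  measurable (A : set (sigmaT J)) -> measurable A.
Proof.
apply: smallest_sub; first exact: sigma_algebra_measurable.
exact: cylinders_measurable.
Qed.

Lemma measurable_fun_sigma_cylindersW J (f : T -> R) :
  measurable_fun setT (f : sigmaT J -> R) -> measurable_fun setT f.
Proof.
by move=> mf _ B mB; exact: sigma_cylinders_measurable (mf measurableT B mB).
Qed.

Hypothesis indepF : mutually_independent P F.

(** Pi-lambda argument: as functions of [A], both sides are finite measures, and they agree on the
    pi-system of cylinders. *)
Lemma sigma_cylinders_independent J k (A : set T) (B : set R) : k \notin J ->
  measurable (A : set (sigmaT J)) -> measurable B ->
  (P (A `&` F k @^-1` B) = P A * P (F k @^-1` B))%E.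
Proof.
move=> kJ mA mB.
have mFB : measurable (F k @^-1` B).
  by rewrite -[X in measurable X]setTI; exact: mF.
have PB0 : 0 <= fine (P (F k @^-1` B)) by exact: fine_ge0.
pose m1 : {measure set T -> \bar R} := mrestr P mFB.
pose m2 : {measure set T -> \bar R} := mscale (NngNum PB0) P.
suff : m1 A = m2 A.
  by rewrite /m1 /m2 /= /mrestr /mscale/= fineK ?fin_num_measure// muleC.
apply: (g_sigma_algebra_measure_unique (cylinders J) _ (fun=> setT)) mA => //.
- exact: cylinders_measurable.
- by move=> _; exact: cylindersT.
- by rewrite bigcup_const.
- exact: cylindersI.
- move=> _ [C mC <-].
  rewrite /m1 /m2 /= /mrestr /mscale/= fineK ?fin_num_measure// muleC.
  (* Placing [B] at coordinate [k] turns the intersection into a cylinder over [k |: J], to which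
     mutual independence applies. *)
  have mC' i : measurable (if i == k then B else C i) by case: ifP.
  have := indepF (k |: J) _ mC'.
  rewrite big_setU1//= eqxx muleC.
  have eqC i : i \in J -> (if i == k then B else C i) = C i.
    by move=> iJ; case: eqP iJ kJ => // -> ->.
  under eq_bigr => i iJ do rewrite eqC//.
  rewrite -indepF// => <-; congr (P _); apply/seteqP; split=> w.
    move=> [Cw Bw] i /=; rewrite !inE => /orP[/eqP ->|iJ].
      by rewrite eqxx.
    by rewrite eqC//; exact: Cw.
  move=> Cw; split.
    move=> i /= iJ; have := Cw i; rewrite /= eqC//; apply.
    by rewrite !inE iJ orbT.
  by have := Cw k; rewrite /= eqxx; apply; rewrite !inE eqxx.
- by move=> _; rewrite /m1 /= /mrestr setTI ltey_eq fin_num_measure.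
Qed.

(** The pair is (identity, [F k]), with [T] itself carrying the coarser sigma-algebra [sigmaT J] as
    first factor. This freezes everything that depends on [J] while [F k] is integrated out. *)
Lemma ge0_integral_cylinders_fubini J k (nu : probability (measurableTypeR R) R)
    (g : T -> R -> R) : k \notin J ->
  (forall B, measurable B -> P (F k @^-1` B) = nu B) ->
  measurable_fun setT (fun z : sigmaT J * measurableTypeR R => g z.1 z.2) ->
  (forall w x, 0 <= g w x) ->
  (\int[P]_w (g w (F k w))%:E = \int[P]_w \int[nu]_x (g w x)%:E)%E.
Proof.
move=> kJ Fnu mg g0.
have mid : measurable_fun setT (id : T -> sigmaT J).
  by move=> _ A mA; rewrite setTI; exact: sigma_cylinders_measurable mA.
apply: (ge0_integral_independent_pair _ _ _ T (sigmaT J) (measurableTypeR R) P id (F k) nu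
  (fun z => (g z.1 z.2)%:E)) => //.
- exact: mF.
- by move=> A B mA mB; rewrite -Fnu//; exact: sigma_cylinders_independent mA mB.
- exact/measurable_EFinP.
- by move=> z; rewrite lee_fin.
Qed.

End cylinders.

(** * Integrating out Gaussian variables one at a time *)

Section gaussian_elimination.
Context {R : realType} {d : measure_display} {T : measurableType d}.
Context (P : probability T R) {I : finType} (F : I -> T -> R).
Hypothesis gF : forall i, std_gaussian P (F i).
Hypothesis indepF : mutually_independent P F.
Implicit Types (J : {set I}) (G : T -> R).

Local Notation sigmaT J := (g_sigma_algebraType (cylinders F J)).

Let mF i : measurable_fun setT (F i). Proof. by case: (gF i). Qed.

Lemma measurable_fun_sigma_lincomb (a : I -> R) (l : seq I) J :
  {subset l <= J} ->
  measurable_fun setT ((fun w => \sum_(i <- l) a i * F i w) : sigmaT J -> R).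
Proof.
elim: l => [|k l IH] lJ.
  by under eq_fun do rewrite big_nil; exact: measurable_cst.
under eq_fun do rewrite big_cons.
apply: measurable_funD; last by apply: IH => i il; apply: lJ; rewrite inE il orbT.
apply: measurable_funM => //.
by apply: measurable_fun_sigma_cylinders; apply: lJ; rewrite mem_head.
Qed.

(** [G], [b] and [e] depend only on variables independent of [F k], so they act as constants in the
    one-dimensional Gaussian integral. *)
Lemma integral_gaussian_out J k (c : R) G (b e : T -> R) :
  k \notin J -> 0 <= c -> (forall w, 0 <= G w) ->
  measurable_fun setT (G : sigmaT J -> R) ->
  measurable_fun setT (b : sigmaT J -> R) ->
  measurable_fun setT (e : sigmaT J -> R) ->
  (\int[P]_w (G w * expR (- (c * F k w ^+ 2) + b w * F k w + e w))%:E =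
   (Num.sqrt (1 + 2 * c))^-1%:E *
   \int[P]_w (G w * expR (b w ^+ 2 / (2 * (1 + 2 * c)) + e w))%:E)%E.
Proof.
move=> kJ c0 G0 mG mb me.
pose g w x := G w * expR (- (c * x ^+ 2) + b w * x + e w).
have m1 (h : T -> R) : measurable_fun setT (h : sigmaT J -> R) ->
    measurable_fun setT (fun z : sigmaT J * measurableTypeR R => h z.1).
  by move=> mh; apply: measurableT_comp mh _; exact: measurable_fst.
have mg : measurable_fun setT (fun z : sigmaT J * measurableTypeR R => g z.1 z.2).
  apply: measurable_funM; first exact: m1.
  apply: measurableT_comp => //; apply: measurable_funD; last exact: m1.
  apply: measurable_funD; last by apply: measurable_funM => //; exact: m1.
  apply: measurableT_comp => //; apply: measurable_funM => //.
  exact: measurable_funX.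
rewrite (ge0_integral_cylinders_fubini P F mF indepF J k
  (normal_prob 0 1) g kJ _ mg); last 2 first.
  by case: (gF k).
  by move=> w x; rewrite mulr_ge0 ?expR_ge0.
have mH : measurable_fun setT
    (fun w => (G w * expR (b w ^+ 2 / (2 * (1 + 2 * c)) + e w))%:E).
  apply/measurable_EFinP; apply: (measurable_fun_sigma_cylindersW F mF J).
  apply: measurable_funM => //; apply: measurableT_comp => //.
  apply: measurable_funD => //; apply: measurable_funM => //.
  exact: measurable_funX.
have H0 w : (0 <= (G w * expR (b w ^+ 2 / (2 * (1 + 2 * c)) + e w))%:E)%E.
  by rewrite lee_fin mulr_ge0 ?expR_ge0.
have K0 : 0 <= (Num.sqrt (1 + 2 * c))^-1 by rewrite invr_ge0 sqrtr_ge0.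
rewrite -ge0_integralZl_EFin//.
apply: eq_integral => w _.
have mq : measurable_fun setT
    (fun x : R => (expR (- (c * x ^+ 2) + b w * x))%:E).
  apply/measurable_EFinP; apply: measurableT_comp => //.
  apply: measurable_funD; last exact: measurable_funM.
  by apply: measurableT_comp => //; exact: measurable_funM.
transitivity (\int[normal_prob 0 1]_x
    ((G w * expR (e w))%:E * (expR (- (c * x ^+ 2) + b w * x))%:E))%E.
  by apply: eq_integral => x _; rewrite -EFinM /g expRD; congr EFin; ring.
rewrite ge0_integralZl_EFin//; last by rewrite mulr_ge0 ?expR_ge0.
rewrite integral_std_normal_expR_quadratic// -!EFinM expRD; congr EFin; ring.
Qed.

(** Induction on [l]: integrating out the head replaces [c] by [c' = c / (1 + 2c)], and the
    normalising factors telescope because [(1 + 2c)(1 + 2c'm) = 1 + 2c(m + 1)]. *)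
Lemma integral_gaussian_lincomb_sqr J (a : I -> R) (l : seq I) (c : R) G :
  0 <= c -> uniq l -> {in l, forall i, i \notin J} ->
  {in l, forall i, a i ^+ 2 = 1} -> (forall w, 0 <= G w) ->
  measurable_fun setT (G : sigmaT J -> R) ->
  (\int[P]_w (G w * expR (- (c * (\sum_(i <- l) a i * F i w) ^+ 2)))%:E =
   (Num.sqrt (1 + 2 * c * (size l)%:R))^-1%:E * \int[P]_w (G w)%:E)%E.
Proof.
move=> + + + + G0 mG; elim: l c => [|k l IH] c c0.
  move=> _ _ _; rewrite /= mulr0 addr0 sqrtr1 invr1 mul1e.
  apply: eq_integral => w _.
  by rewrite big_nil expr0n/= mulr0 oppr0 expR0 mulr1.
move=> /= /andP[kl ul] lJ a1.
pose U w := \sum_(i <- l) a i * F i w.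
pose J' := J :|: [set i | i \in l].
have mU : measurable_fun setT (U : sigmaT J' -> R).
  by apply: measurable_fun_sigma_lincomb => i il; rewrite !inE il orbT.
have kJ' : k \notin J' by rewrite !inE (negbTE kl) orbF lJ ?mem_head.
have q0 : 0 < 1 + 2 * c by lra.
transitivity (\int[P]_w (G w * expR (- (c * F k w ^+ 2) +
   (- (2 * c * a k) * U w) * F k w + - (c * U w ^+ 2)))%:E)%E.
  apply: eq_integral => w _; rewrite big_cons -/(U w); congr (_ * expR _)%:E.
  have -> : c * (a k * F k w + U w) ^+ 2 =
    c * (a k ^+ 2 * F k w ^+ 2) + 2 * c * a k * U w * F k w + c * U w ^+ 2 by ring.
  by rewrite a1 ?mem_head//; ring.
rewrite (integral_gaussian_out J')//; last 3 first.
- by apply: measurable_fun_sigma_cylinders_sub mG; exact: finset.subsetUl.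
- exact: measurable_funM.
- apply: measurableT_comp => //; apply: measurable_funM => //.
  exact: measurable_funX.
(* The coefficient of [U w ^+ 2] becomes [2c^2 / (1 + 2c) - c = - c'], using that [a k] squares to
   1. *)
pose c' := c / (1 + 2 * c).
have c'0 : 0 <= c' by rewrite divr_ge0// ltW.
have -> : (\int[P]_w (G w * expR ((- (2 * c * a k) * U w) ^+ 2 /
    (2 * (1 + 2 * c)) + - (c * U w ^+ 2)))%:E =
    \int[P]_w (G w * expR (- (c' * U w ^+ 2)))%:E)%E.
  apply: eq_integral => w _; congr (_ * expR _)%:E.
  have -> : (- (2 * c * a k) * U w) ^+ 2 = 4 * c ^+ 2 * a k ^+ 2 * U w ^+ 2 by ring.
  rewrite a1 ?mem_head// /c'; field.
  by rewrite gt_eqF.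
rewrite IH//; last 2 first.
- by move=> i il; apply: lJ; rewrite inE il orbT.
- by move=> i il; apply: a1; rewrite inE il orbT.
rewrite muleA -EFinM; congr (_%:E * _)%E.
rewrite -invfM -sqrtrM ?ltW//; congr (Num.sqrt _)^-1.
by rewrite /c' -natr1; field; rewrite gt_eqF.
Qed.

(** The square of [F k] cancels in the exponent, which is therefore linear in [F k]. Integrating it
    out leaves [exp(- U^2 / (8 s^2))], and [integral_gaussian_lincomb_sqr] with [c = 1 / (8 s^2)]
    evaluates the rest. [G] is meant to hold the factors of the other rows. *)
Lemma integral_gaussian_row J (a : I -> R) (l : seq I) k (s : R) G :
  0 < s -> uniq l -> {in l, forall i, i \notin J} ->
  k \notin J -> k \notin l ->
  {in l, forall i, a i ^+ 2 = 1} -> (forall w, 0 <= G w) ->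
  measurable_fun setT (G : sigmaT J -> R) ->
  (\int[P]_w (G w * expR ((F k w ^+ 2 -
     (F k w + (\sum_(i <- l) a i * F i w) / s) ^+ 2) / 4))%:E =
   (Num.sqrt (1 + (size l)%:R / (4 * s ^+ 2)))^-1%:E * \int[P]_w (G w)%:E)%E.
Proof.
move=> s0 ul lJ kJ kl a1 G0 mG.
pose U w := \sum_(i <- l) a i * F i w.
pose J' := J :|: [set i | i \in l].
have mU : measurable_fun setT (U : sigmaT J' -> R).
  by apply: measurable_fun_sigma_lincomb => i il; rewrite !inE il orbT.
have kJ' : k \notin J' by rewrite !inE (negbTE kl) orbF.
transitivity (\int[P]_w (G w * expR (- (0 * F k w ^+ 2) +
   (- (2 * s)^-1 * U w) * F k w + - ((4 * s ^+ 2)^-1 * U w ^+ 2)))%:E)%E.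
  apply: eq_integral => w _; rewrite -/(U w); congr (_ * expR _)%:E.
  by field; rewrite gt_eqF.
rewrite (integral_gaussian_out J')//; last 3 first.
- by apply: measurable_fun_sigma_cylinders_sub mG; exact: finset.subsetUl.
- exact: measurable_funM.
- apply: measurableT_comp => //; apply: measurable_funM => //.
  exact: measurable_funX.
rewrite mulr0 addr0 sqrtr1 invr1 mul1e.
pose c := (8 * s ^+ 2)^-1.
have c0 : 0 <= c by rewrite invr_ge0 mulr_ge0// sqr_ge0.
have -> : 1 + (size l)%:R / (4 * s ^+ 2) = 1 + 2 * c * (size l)%:R.
  by rewrite /c; field; rewrite gt_eqF.
rewrite -(integral_gaussian_lincomb_sqr J a l c)//.
apply: eq_integral => w _; congr (_ * expR _)%:E.
by rewrite -/(U w) /c; field; rewrite gt_eqF.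
Qed.
End gaussian_elimination.

(** * Chernoff and union bounds for the maximum likelihood estimator *)

Lemma measure_bigsetU_le {R : realType} {d : measure_display}
  {T : measurableType d} (mu : {measure set T -> \bar R}) (I : Type)
  (r : seq I) (Q : pred I) (A : I -> set T) :
  (forall i, measurable (A i)) ->
  (mu (\big[setU/set0]_(i <- r | Q i) A i) <= \sum_(i <- r | Q i) mu (A i))%E.
Proof.
move=> mA.
suff [] : measurable (\big[setU/set0]_(i <- r | Q i) A i) /\
  (mu (\big[setU/set0]_(i <- r | Q i) A i) <= \sum_(i <- r | Q i) mu (A i))%E.
  by [].
elim/big_rec2: _ => [|i y B _ [mB IH]]; first by rewrite measure0.
split; first exact: measurableU.
by apply: le_trans (measureU2 _ _ _) _ => //; exact: leeD.
Qed.

Section regression.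
Context {R : realType} {d : measure_display} {T : measurableType d}.
Context (P : probability T R) {n p : nat}.
Context (X : 'I_n -> 'I_p -> T -> R) (W : 'I_n -> T -> R) (sig : 'I_n -> R).
Context (Sstar : {set 'I_p}).
Implicit Types S : {set 'I_p}.

Let F (a : ('I_n * 'I_p) + 'I_n) : T -> R :=
  match a with inl ij => X ij.1 ij.2 | inr i => W i end.

Hypothesis indepF : mutually_independent P F.
Hypothesis gX : forall i j, std_gaussian P (X i j).
Hypothesis gW : forall i, std_gaussian P (W i).
Hypothesis sig_gt0 : forall i, 0 < sig i.

Let Y w i : R :=
  design_apply (fun i j => X i j w) (beta_of Sstar) i + sig i * W i w.

Let obj S w := mle_objective sig (Y w) (fun i j => X i j w) (beta_of S).

Let gF a : std_gaussian P (F a). Proof. by case: a => [[i j]|i] /=. Qed.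
Let mF a : measurable_fun setT (F a). Proof. by case: (gF a). Qed.

Let coef S (a : ('I_n * 'I_p) + 'I_n) : R :=
  match a with inl ij => beta_of Sstar ij.2 - beta_of S ij.2 | inr _ => 0 end.

Let row_idx S i : seq (('I_n * 'I_p) + 'I_n) :=
  [seq inl (i, j) | j <- enum (symdiff Sstar S)].

(* At exponent t, integrating out W_i leaves exp(- (t - 2 t^2) U_i^2 / sig_i^2);
   t = 1/4 maximises t - 2 t^2. *)
Let gain S i w := expR ((W i w ^+ 2 -
  (W i w + (\sum_(a <- row_idx S i) coef S a * F a w) / sig i) ^+ 2) / 4).

(** All design and noise variables of the rows in [r]. The variables of a row outside [r] avoid this
    set, so that row can be integrated out first. *)
Let rows (r : seq 'I_n) : {set ('I_n * 'I_p) + 'I_n} :=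
  [set a | match a with inl ij => ij.1 \in r | inr i => i \in r end].

Lemma measurable_mle_objective S : measurable_fun setT (obj S).
Proof.
have mX i j : measurable_fun setT (X i j) by case: (gX i j).
have mW i : measurable_fun setT (W i) by case: (gW i).
have md S' i : measurable_fun setT
    (fun w => design_apply (fun i j => X i j w) (beta_of S') i).
  by apply: measurable_sum => j; exact: measurable_funM.
apply: measurable_sum => i; apply: measurable_funX; apply: measurable_funM => //.
apply: measurable_funB => //; apply: measurable_funD => //.
exact: measurable_funM.
Qed.

Let in_symdiff S j : (j \in symdiff Sstar S) = (j \in Sstar) (+) (j \in S).
Proof. by rewrite !inE; case: (j \in Sstar); case: (j \in S). Qed.

Let coef_sqr S i : {in row_idx S i, forall a, coef S a ^+ 2 = 1}.
Proof.
move=> _ /mapP[j + ->]; rewrite mem_enum in_symdiff /= /beta_of.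
by case: (j \in Sstar); case: (j \in S) => //= _; ring.
Qed.

Let design_sub S i w : \sum_(a <- row_idx S i) coef S a * F a w =
  design_apply (fun i j => X i j w) (beta_of Sstar) i -
  design_apply (fun i j => X i j w) (beta_of S) i.
Proof.
rewrite big_map big_enum/= /design_apply -sumrB big_mkcond/=.
apply: eq_bigr => j _; rewrite in_symdiff /beta_of.
by case: (j \in Sstar); case: (j \in S) => /=; ring.
Qed.

(** The scaled residual of row [i] is [W i w] at the true support, and [W i w] plus the scaled
    signed sum over [row_idx S i] at [S]. *)
Let prod_gainE S w :
  \prod_(i <- index_enum 'I_n) gain S i w = expR ((obj Sstar w - obj S w) / 4).
Proof.
rewrite -expR_sum -mulr_suml sumrB; congr (expR ((_ - _) / 4)).
  by apply: eq_bigr => i _; rewrite /Y; congr (_ ^+ 2); field; rewrite gt_eqF.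
apply: eq_bigr => i _; rewrite design_sub /Y; congr (_ ^+ 2).
by field; rewrite gt_eqF.
Qed.

Let measurable_gain S i r : i \in r ->
  measurable_fun setT (gain S i : g_sigma_algebraType (cylinders F (rows r)) -> R).
Proof.
move=> ir.
have mWi : measurable_fun setT
    (W i : g_sigma_algebraType (cylinders F (rows r)) -> R).
  by apply: (measurable_fun_sigma_cylinders F (inr i)); rewrite inE.
apply: measurableT_comp => //; apply: measurable_funM => //.
apply: measurable_funB; apply: measurable_funX => //.
apply: measurable_funD => //; apply: measurable_funM => //.
apply: measurable_fun_sigma_lincomb => _ /mapP[j _ ->].
by rewrite inE.
Qed.

Lemma integral_prod_gain S (r : seq 'I_n) : uniq r ->
  (\int[P]_w (\prod_(i <- r) gain S i w)%:E =
   (\prod_(i <- r) (Num.sqrt (1 + #|symdiff Sstar S|%:R / (4 * sig i ^+ 2)))^-1)%:E)%E.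
Proof.
elim: r => [_|i r IH /= /andP[ir ur]].
  under eq_integral do rewrite big_nil.
  by rewrite big_nil integral_cst//= mul1e probability_setT.
under eq_integral do rewrite big_cons mulrC.
have -> := integral_gaussian_row P F gF indepF (rows r) (coef S) (row_idx S i)
  (inr i) (sig i) (fun w => \prod_(i <- r) gain S i w).
- by rewrite size_map -cardE IH// -EFinM big_cons.
- exact: sig_gt0.
- by rewrite map_inj_uniq ?enum_uniq// => j j' [].
- by move=> _ /mapP[j _ ->]; rewrite inE.
- by rewrite inE.
- by apply/mapP => -[].
- exact: coef_sqr.
- by move=> w; apply: prodr_ge0 => j _; exact: expR_ge0.
- by apply: measurable_prod => j jr; exact: measurable_gain.
Qed.

(** On the event the exponent [(obj Sstar w - obj S w) / 4] is nonnegative, so the indicator is at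
    most the product of the gains. *)
Lemma probability_mle_objective_le S :
  (P [set w | (obj S w <= obj Sstar w)%R] <=
   (\prod_(i < n) (Num.sqrt (1 + #|symdiff Sstar S|%:R / (4 * sig i ^+ 2)))^-1)%:E)%E.
Proof.
set A := [set w | _].
have mA : measurable A.
  rewrite -[A]setTI; apply: measurable_fun_le => //;
    exact: measurable_mle_objective.
rewrite -(integral_prod_gain S _ (index_enum_uniq _)).
rewrite -[X in (P X <= _)%E]setIT -integral_indic//.
under [leRHS]eq_integral do rewrite prod_gainE.
apply: ge0_le_integral => //.
- by apply/measurable_EFinP; exact: measurable_indic.
- apply/measurable_EFinP; apply: measurableT_comp => //.
  by apply: measurable_funM => //; apply: measurable_funB;
    exact: measurable_mle_objective.
- move=> w _; rewrite lee_fin indicE; have [wA|_] := boolP (w \in A).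
    rewrite -[leLHS]expR0 ler_expR divr_ge0// subr_ge0.
    by move: wA; rewrite inE.
  exact: expR_ge0.
Qed.

Let recovered (s : nat) (delta : R) : set T :=
  [set w | forall S, in_Bps s S ->
    (forall S', in_Bps s S' -> obj S w <= obj S' w) ->
    #|symdiff Sstar S|%:R < 2 * delta * s%:R].

Lemma measurable_mle_recovered s delta : measurable (recovered s delta).
Proof.
have -> : recovered s delta = \bigcap_(S in [set S | in_Bps s S /\
    ~ (#|symdiff Sstar S|%:R < 2 * delta * s%:R)])
  ~` (\bigcap_(S' in [set S' | in_Bps s S']) [set w | obj S w <= obj S' w]).
  apply/seteqP; split=> w.
    by move=> Ew S [sS nS] min; apply: nS; apply: Ew => // S' sS'; exact: min.
  move=> Ew S sS min; apply: contrapT => nS.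
  by apply: (Ew S) => // S' sS'; exact: min.
apply: fin_bigcap_measurable; first exact: finite_finset.
move=> S _; apply: measurableC.
apply: fin_bigcap_measurable; first exact: finite_finset.
move=> S' _; rewrite -[X in measurable X]setTI.
by apply: measurable_fun_le => //; exact: measurable_mle_objective.
Qed.

Lemma probability_mle_recovered s delta (B : R) :
  in_Bps s Sstar -> 0 <= B ->
  (forall S, 2 * delta * s%:R <= #|symdiff Sstar S|%:R ->
    \prod_(i < n) (Num.sqrt (1 + #|symdiff Sstar S|%:R / (4 * sig i ^+ 2)))^-1
    <= B) ->
  ((1 - 'C(p, s)%:R * B)%:E <= P (recovered s delta))%E.
Proof.
move=> sSstar B0 hB.
have mE := measurable_mle_recovered s delta.
pose bad S := in_Bps s S && (2 * delta * s%:R <= #|symdiff Sstar S|%:R).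
pose A S := [set w | obj S w <= obj Sstar w].
have mA S : measurable (A S).
  rewrite -[A S]setTI; apply: measurable_fun_le => //;
    exact: measurable_mle_objective.
(* On failure some minimiser [S] is bad, and comparing it with [Sstar], itself a candidate, puts [w]
   in [A S]. *)
have sub : ~` recovered s delta `<=` \big[setU/set0]_(S | bad S) A S.
  move=> w nE; apply: contrapT => nA; apply: nE => S sS min.
  rewrite ltNge; apply/negP => hS; apply: nA.
  rewrite -bigcup_seq_cond; exists S; last exact: min.
  by rewrite /= mem_index_enum /bad sS.
have : (P (~` recovered s delta) <= ('C(p, s)%:R * B)%:E)%E.
  apply: le_trans (le_measure _ _ _ sub) _; rewrite ?inE.
  - exact: measurableC.
  - by apply: bigsetU_measurable.
  apply: le_trans (measure_bigsetU_le _ _ _ _ _ mA) _.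
  apply: (@le_trans _ _ (\sum_(S : {set 'I_p} | bad S) B%:E)%E).
    apply: lee_sum => S /andP[_ hS].
    by apply: le_trans (probability_mle_objective_le S) _; rewrite lee_fin hB.
  rewrite sumEFin lee_fin sumr_const -[leLHS]mulr_natl ler_wpM2r// ler_nat.
  rewrite -[X in 'C(X, _)]card_ord -card_draws -cardsE; apply: subset_leq_card.
  by apply/fintype.subsetP => S; rewrite !inE => /andP[].
rewrite probability_setC//.
rewrite -(fineK (fin_num_measure P _ mE)) -EFinB !lee_fin; lra.
Qed.

End regression.

(** * Bounds on the Chernoff product and on binomial coefficients *)

Lemma inv_sqrt_le_expR_ln {R : realType} (u v : R) : 0 <= u -> u <= v ->
  (Num.sqrt (1 + v))^-1 <= expR (- (ln (1 + u) / 2)).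
Proof.
move=> u0 uv.
have q0 : 0 < 1 + u by lra.
have -> : expR (- (ln (1 + u) / 2)) = (Num.sqrt (1 + u))^-1.
  rewrite expRN; congr (_^-1).
  by rewrite -powR12_sqrt ?ltW// /powR gt_eqF// mulrC.
rewrite lef_pV2 ?posrE ?sqrtr_gt0//; last by lra.
by rewrite ler_wsqrtr// lerD2l.
Qed.

(** With [x = delta s], the threshold [2 x <= D] gives [D / (4 t^2) >= x / (2 t^2)], which produces
    the logarithms of the sample size hypothesis. The index range splits by noise level. *)
Lemma prod_noise_level_le {R : realType} (n1 n2 : nat) (s1 s2 x D : R) :
  0 < s1 -> 0 < s2 -> 0 <= x -> 2 * x <= D ->
  \prod_(i < n1 + n2)
    (Num.sqrt (1 + D / (4 * noise_level n1 s1 s2 i ^+ 2)))^-1 <=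
  expR (- ((n1%:R * ln (1 + x / (2 * s1 ^+ 2)) +
            n2%:R * ln (1 + x / (2 * s2 ^+ 2))) / 2)).
Proof.
move=> s10 s20 x0 xD.
have factor t : 0 < t -> (Num.sqrt (1 + D / (4 * t ^+ 2)))^-1 <=
    expR (- (ln (1 + x / (2 * t ^+ 2)) / 2)).
  move=> t0; apply: inv_sqrt_le_expR_ln.
    by rewrite divr_ge0// mulr_ge0// sqr_ge0.
  have -> : x / (2 * t ^+ 2) = (2 * x) / (4 * t ^+ 2) by field; rewrite gt_eqF.
  by rewrite ler_wpM2r// invr_ge0 mulr_ge0// sqr_ge0.
set l1 := ln (1 + x / (2 * s1 ^+ 2)); set l2 := ln (1 + x / (2 * s2 ^+ 2)).
have -> : - ((n1%:R * l1 + n2%:R * l2) / 2) =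
    n1%:R * - (l1 / 2) + n2%:R * - (l2 / 2) by ring.
rewrite expRD !expRM_natl big_split_ord/=.
apply: ler_pM.
- by apply: prodr_ge0 => i _; rewrite invr_ge0 sqrtr_ge0.
- by apply: prodr_ge0 => i _; rewrite invr_ge0 sqrtr_ge0.
- rewrite -[X in _ ^+ X]card_ord -prodr_const; apply: ler_prod => i _.
  by rewrite invr_ge0 sqrtr_ge0/= /noise_level /= ltn_ord factor.
- rewrite -[X in _ ^+ X]card_ord -prodr_const; apply: ler_prod => i _.
  by rewrite invr_ge0 sqrtr_ge0/= /noise_level /= ltnNge leq_addr factor.
Qed.

(** The left side is a single term of the binomial expansion, whose terms are all nonnegative. *)
Lemma bin_exprn_le {R : realType} (p s : nat) (x y : R) :
  0 <= x -> 0 <= y -> (s <= p)%N ->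
  'C(p, s)%:R * (x ^+ (p - s) * y ^+ s) <= (x + y) ^+ p.
Proof.
move=> x0 y0 sp; have sp1 : (s < p.+1)%N by [].
rewrite exprDn (bigD1 (Ordinal sp1))//= mulr_natl lerDl.
by apply: sumr_ge0 => i _; rewrite mulrn_wge0// mulr_ge0// exprn_ge0.
Qed.

(** Take [x = 1] and [y = s / p] in [bin_exprn_le]; then [(1 + s / p)^p <= exp(s)]. *)
Lemma bin_le_expR_ln {R : realType} (p s : nat) : (0 < s <= p)%N ->
  'C(p, s)%:R <= expR (s%:R * ln (p%:R / s%:R) + s%:R) :> R.
Proof.
move=> /andP[s0 sp].
have p0 : (0 < p)%N by exact: leq_trans sp.
have s0R : 0 < s%:R :> R by rewrite ltr0n.
have p0R : 0 < p%:R :> R by rewrite ltr0n.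
have y0 : 0 < s%:R / p%:R :> R by rewrite divr_gt0.
have := bin_exprn_le p s 1 (s%:R / p%:R) ler01 (ltW y0) sp.
rewrite expr1n mul1r -ler_pdivlMr ?exprn_gt0// => /le_trans; apply.
rewrite expRD expRM_natl lnK ?posrE ?divr_gt0// mulrC -exprVn invf_div.
rewrite ler_wpM2l ?exprn_ge0 ?divr_ge0//.
apply: (@le_trans _ _ (expR (s%:R / p%:R) ^+ p)).
  rewrite lerXn2r ?nnegrE ?expR_ge0 ?expR_ge1Dx// addr_ge0// ltW//.
by rewrite -expRM_natl mulrC divfK// gt_eqF.
Qed.

(** Take [x = 1 - a] and [y = a] in [bin_exprn_le]: the total is 1, and
    [(1 - a)^(p - s) a^s = exp(- h(a) p)]. *)
Lemma bin_le_expR_entropy {R : realType} (p s : nat) (a : R) :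
  0 < a < 1 -> s%:R = a * p%:R -> (s <= p)%N ->
  'C(p, s)%:R <= expR (bin_entropy a * p%:R).
Proof.
move=> /andP[a0 a1] sE sp.
have b0 : 0 < 1 - a by lra.
have := bin_exprn_le p s (1 - a) a (ltW b0) (ltW a0) sp.
rewrite subrK expr1n -ler_pdivlMr ?mulr_gt0 ?exprn_gt0// => /le_trans; apply.
rewrite div1r -[X in (X ^+ (p - s) * _)^-1]lnK ?posrE//.
rewrite -[X in (_ * X ^+ s)^-1]lnK ?posrE// -!expRM_natl -expRD -expRN.
rewrite ler_expR natrB// sE /bin_entropy; lra.
Qed.

Lemma bin_entropy_gt0 {R : realType} (a : R) : 0 < a < 1 -> 0 < bin_entropy a.
Proof.
move=> /andP[a0 a1]; rewrite /bin_entropy mulNr -opprD oppr_gt0.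
rewrite addrC -[ltRHS]addr0 ltrD//; rewrite nmulr_llt0 ?ln_lt0//; lra.
Qed.

(** * Asymptotics and the two sparsity settings *)

Lemma cvg_expRN0 {R : realType} (e : nat -> R) :
  e @ \oo --> +oo -> expR (- e k) @[k --> \oo] --> 0.
Proof.
by move=> eoo; exact: (cvg_comp e (fun x => expR (- x)) eoo (@cvgr_expR R)).
Qed.

Lemma ln_inv_ratio_large {R : realType} (p s : nat -> nat) (M : R) :
  (forall k, (s k <= p k)%N) ->
  ((s k)%:R / (p k)%:R : R) @[k --> \oo] --> 0 ->
  ((s k)%:R : R) @[k --> \oo] --> +oo ->
  \forall k \near \oo, M < ln ((p k)%:R / (s k)%:R).
Proof.
move=> sp sp0 soo; near=> k.
have sk0 : 0 < (s k)%:R :> R by near: k; exact: (cvgryPgt _).1.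
have pk0 : 0 < (p k)%:R :> R by apply: lt_le_trans sk0 _; rewrite ler_nat.
have : `|(s k)%:R / (p k)%:R| < expR (- M).
  by near: k; move/cvgr0Pnorm_lt : sp0; apply; exact: expR_gt0.
rewrite gtr0_norm ?divr_gt0// expRN -ltf_pV2 ?posrE ?invr_gt0 ?expR_gt0 ?divr_gt0//.
by rewrite invrK invf_div -ltr_expR lnK ?posrE ?divr_gt0.
Unshelve. all: by end_near. Qed.

Theorem theorem2 (R : realType)
  (* the model is indexed by k; p k -> +oo along it *)
  (p n1 n2 s : nat -> nat) (sigma1 sigma2 : nat -> R)
  (Sstar : forall k, {set 'I_(p k)})
  (dT : nat -> measure_display) (T : forall k, measurableType (dT k))
  (P : forall k, probability (T k) R)
  (X : forall k, 'I_(n1 k + n2 k) -> 'I_(p k) -> T k -> R)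
  (W : forall k, 'I_(n1 k + n2 k) -> T k -> R)
  (delta : R) (nstar : nat -> R) :
  ((p k)%:R : R) @[k --> \oo] --> +oo ->
  (forall k, (1 <= n1 k)%N /\ (1 <= n2 k)%N) ->
  (forall k, 0 < sigma1 k ^+ 2 < sigma2 k ^+ 2) ->
  (forall k, 0 < sigma1 k) -> (forall k, 0 < sigma2 k) ->
  (forall k, in_Bps (s k) (Sstar k)) ->
  (forall k, mutually_independent (P k)
     (fun a : ('I_(n1 k + n2 k) * 'I_(p k)) + 'I_(n1 k + n2 k) =>
        match a with inl ij => X k ij.1 ij.2 | inr i => W k i end)) ->
  (forall k i j, std_gaussian (P k) (X k i j)) ->
  (forall k i, std_gaussian (P k) (W k i)) ->
  0 < delta < 1 ->
  ( (* setting 1: s = o(p), s -> +oo, n* = 2 s log(p/s) *)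
    (((s k)%:R / (p k)%:R : R) @[k --> \oo] --> 0 /\
     ((s k)%:R : R) @[k --> \oo] --> +oo /\
     (forall k, nstar k = 2 * (s k)%:R * ln ((p k)%:R / (s k)%:R)))
  \/ (* setting 2: s = alpha p, n* = 2 h(alpha) p *)
    (exists alpha : R, 0 < alpha < 1 /\
     (forall k, (s k)%:R = alpha * (p k)%:R) /\
     (forall k, nstar k = 2 * bin_entropy alpha * (p k)%:R)) ) ->
  forall eps : R, 0 < eps ->
  (\forall k \near \oo,
     (n1 k)%:R * ln (1 + delta * (s k)%:R / (2 * sigma1 k ^+ 2))
     + (n2 k)%:R * ln (1 + delta * (s k)%:R / (2 * sigma2 k ^+ 2))
     >= (1 + eps) * nstar k) ->
  let sig k := noise_level (n1 k) (sigma1 k) (sigma2 k) (n := n1 k + n2 k) in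
  let Y k (w : T k) (i : 'I_(n1 k + n2 k)) : R :=
    design_apply (fun i j => X k i j w) (beta_of (Sstar k)) i
    + sig k i * W k i w in
  (* event: every MLE over B_{p,s} has |supp beta* (triangle) supp beta_hat| < 2 delta s *)
  let E k : set (T k) := [set w | forall S : {set 'I_(p k)}, in_Bps (s k) S ->
      (forall S' : {set 'I_(p k)}, in_Bps (s k) S' ->
         mle_objective (sig k) (Y k w) (fun i j => X k i j w) (beta_of S)
         <= mle_objective (sig k) (Y k w) (fun i j => X k i j w) (beta_of S')) ->
      (#|symdiff (Sstar k) S|%:R < 2 * delta * (s k)%:R)] in
  exists o1 : nat -> R, o1 @ \oo --> 0 /\
    (\forall k \near \oo,
       (1 - expR (- ((eps + o1 k) * nstar k / 2)))%:E <= P k (E k))%E /\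
    ((fun k => P k (E k)) @ \oo --> 1%:E).
Proof.
move=> poo _ _ s10 s20 inB indep gX gW /andP[d0 d1] setting eps eps0 hyp sig Y E.
have sp k : (s k <= p k)%N.
  by rewrite -(eqP (inB k)) -[X in (_ <= X)%N]card_ord; exact: max_card.
have sig0 k i : 0 < sig k i by rewrite /sig /noise_level; case: ifP.
have mE k : measurable (E k).
  exact: (measurable_mle_recovered (P k) (X k) (W k) (sig k) (Sstar k)
    (gX k) (gW k) (s k) delta).
pose L k := (n1 k)%:R * ln (1 + delta * (s k)%:R / (2 * sigma1 k ^+ 2))
     + (n2 k)%:R * ln (1 + delta * (s k)%:R / (2 * sigma2 k ^+ 2)).
have PE k : ((1 - 'C(p k, s k)%:R * expR (- (L k / 2)))%:E <= P k (E k))%E.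
  apply: (probability_mle_recovered (P k) (X k) (W k) (sig k) (Sstar k)) => //.
  move=> S hS; apply: prod_noise_level_le => //.
    by rewrite mulr_ge0// ltW.
  by rewrite mulrA.
(* The correction [o1] absorbs the excess of [ln 'C(p, s)] over [nstar / 2], so only this counting
   bound depends on the setting. Divergence of the exponent then gives the limit 1 by squeezing. *)
suff [u [u0 [bin_le eoo]]] : exists o1 : nat -> R, o1 @ \oo --> 0 /\
    (\forall k \near \oo,
      'C(p k, s k)%:R <= expR ((1 - o1 k) * nstar k / 2)) /\
    (eps + o1 k) * nstar k / 2 @[k --> \oo] --> +oo.
  exists u.
  have lower : \forall k \near \oo,
      ((1 - expR (- ((eps + u k) * nstar k / 2)))%:E <= P k (E k))%E.
    near=> k; apply: le_trans (PE k); rewrite lee_fin lerD2l lerN2.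
    have binL : 'C(p k, s k)%:R <= expR ((1 - u k) * nstar k / 2).
      by near: k.
    apply: le_trans (ler_wpM2r (expR_ge0 _) binL) _.
    rewrite -expRD ler_expR.
    have : (1 + eps) * nstar k <= L k by near: k.
    by lra.
  split=> //; split=> //.
  apply: (@squeeze_cvge _ _ _ _
    (fun k => (1 - expR (- ((eps + u k) * nstar k / 2)))%:E) _ (cst 1%:E)).
  - near=> k; apply/andP; split; first by near: k.
    exact: probability_le1.
  - apply: cvg_EFin; first exact: nearW.
    rewrite -[X in _ --> X]subr0; apply: cvgB; first exact: cvg_cst.
    exact: cvg_expRN0.
  - exact: cvg_cst.
case: setting => [[sp0 [soo nE]]|[a [a01 [sE nE]]]]; last first.
  (* For linear sparsity the entropy bound is already [exp(nstar / 2)], so no correction arises. *)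
  exists (cst 0); split; first exact: cvg_cst.
  have h0 := bin_entropy_gt0 a a01.
  split.
    apply: nearW => k; apply: le_trans (bin_le_expR_entropy _ _ _ a01 (sE k) (sp k)) _.
    by rewrite ler_expR nE /=; lra.
  have -> : (fun k => (eps + cst 0 k) * nstar k / 2) =
      (fun k => (eps * bin_entropy a) * (p k)%:R).
    by apply/funext => k; rewrite nE /=; field.
  apply/cvgryPge => M; near=> k; rewrite -ler_pdivrMl ?mulr_gt0//.
  by near: k; exact: (cvgryPge _).1.
have lnoo M := ln_inv_ratio_large p s M sp sp0 soo.
(* With [l = ln (p / s)], this choice gives [(1 - o1) nstar / 2 = s l + s], exactly the exponent in
   [bin_le_expR_ln]. *)
exists (fun k => - (ln ((p k)%:R / (s k)%:R))^-1); split.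
  apply/cvgr0Pnorm_lt => e e0; near=> k.
  have le : e^-1 < ln ((p k)%:R / (s k)%:R) by near: k; exact: lnoo.
  have l0 : 0 < ln ((p k)%:R / (s k)%:R) :> R by apply: lt_trans le; rewrite invr_gt0.
  by rewrite normrN normfV gtr0_norm// invf_plt ?posrE.
split.
  near=> k.
  have l0 : 0 < ln ((p k)%:R / (s k)%:R) :> R by near: k; exact: lnoo.
  have sk0 : (0 < s k)%N.
    by rewrite -(ltr0n R); near: k; exact: (cvgryPgt _).1.
  have ksp : (0 < s k <= p k)%N by rewrite sk0 sp.
  apply: le_trans (bin_le_expR_ln _ _ ksp) _; rewrite ler_expR nE.
  rewrite le_eqVlt; apply/orP; left; apply/eqP; field.
  by rewrite gt_eqF.
apply/cvgryPge => M; near=> k.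
(* Beyond [2 / eps] one has [eps l - 1 > 1], so the exponent [s (eps l - 1)] is at least [s], which
   diverges. *)
have le : 2 / eps < ln ((p k)%:R / (s k)%:R) by near: k; exact: lnoo.
have l0 : 0 < ln ((p k)%:R / (s k)%:R) :> R by near: k; exact: lnoo.
have sM : M <= (s k)%:R by near: k; exact: (cvgryPge _).1.
apply: le_trans sM _; rewrite nE.
set l := ln _ in le l0 *.
have -> : (eps - l^-1) * (2 * (s k)%:R * l) / 2 = (s k)%:R * (eps * l - 1).
  by field; rewrite gt_eqF.
rewrite ler_peMr//.
by move: le; rewrite ltr_pdivrMr// mulrC; lra.
Unshelve. all: by end_near. Qed.
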